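(* Let $k$ be an algebraically closed field of characteristic zero, let $P=k[x_1,\ldots,x_n]$, and let $f\in P$ be a weighted homogeneous polynomial defining an isolated hypersurface singularity at the origin. Put $A=P/(f)$. If $A$ is singular (i.e. not regular), then $$\operatorname{der}^2(A)\neq \operatorname{Der}^2(A).$$ Consequently, for such $A$: if $\operatorname{der}^2(A)=\operatorname{Der}^2(A)$, then $A$ is regular (the Singh Conjecture for $A$); and hence, if the higher order derivations of $A$ are generated by first order derivations, then $A$ is regular (the Nakai Conjecture for $A$).
   Context: Weighted homogeneous: there are positive integers $w_1,\ldots,w_n$ (weights) and a positive integer $d$ (weighted degree) such that every monomial $x^\alpha$ occurring in $f$ satisfies $\sum_{i=1}^n w_i\alpha_i=d$. Isolated hypersurface singularity at the origin: the origin is an isolated point of the common zero locus of $f,\partial f/\partial x_1,\ldots,\partial f/\partial x_n$. Differential operators: for a $k$-algebra $R$ put $\operatorname{Diff}^q(R)=0$ for $q<0$, and for $q\ge 0$ define inductively $$\operatorname{Diff}^q(R)=\{D\in\operatorname{Hom}_k(R,R): [D,a]\in\operatorname{Diff}^{q-1}(R)\text{ for every }a\in R\},$$ where $a\in R$ is identified with multiplication by $a$. Derivations of order at most $q$: $\operatorname{Der}^q(R)=\{D\in\operatorname{Diff}^q(R): D(1)=0\}$, an $R$-module under left multiplication. For $q\ge1$, $\operatorname{der}^q(R)$ is the $R$-submodule of $\operatorname{Der}^q(R)$ generated by all compositions $\delta_1\delta_2\cdots\delta_s$ with $1\le s\le q$ and $\delta_i\in\operatorname{Der}^1(R)$. ''The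 higher order derivations of $A$ are generated by first order derivations'' means $\operatorname{der}^q(A)=\operatorname{Der}^q(A)$ for every $q\ge 1$. *)

(* Defs.v *)
From HB Require Import structures.
From mathcomp Require Import all_boot all_order all_algebra ring_quotient.
From mathcomp Require Import mpoly.

Set Implicit Arguments.
Unset Strict Implicit.
Unset Printing Implicit Defensive.

Import GRing.Theory.
Local Open Scope ring_scope.

Section DiffOps.
Variables (k : fieldType) (R : comAlgType k).
Implicit Types (D E : R -> R) (q : nat).

Definition commutator D (a : R) : R -> R := fun x => D (a * x) - a * D x.

(* At q = 0 the condition on commutators is [D, a] = 0, since Diff^q = 0 for
   q < 0. *)
Fixpoint Diff q D : Prop :=
  linear D /\
  forall a : R,
    match q with
    | 0%N => commutator D a =1 (fun=> 0)
    | q'.+1 => Diff q' (commutator D a)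
    end.

Definition Der q D : Prop := Diff q D /\ D 1 = 0.

Definition composition s (delta : 'I_s -> R -> R) : R -> R :=
  \big[(fun D E => D \o E)/id]_(i < s) delta i.

Definition is_composition q E : Prop :=
  exists (s : nat) (delta : 'I_s -> R -> R),
    [/\ (1 <= s <= q)%N, forall i, Der 1 (delta i) & E = composition delta].

(* The left R-submodule generated by the compositions: their finite R-linear
   combinations. *)
Definition der q D : Prop :=
  exists (m : nat) (a : 'I_m -> R) (E : 'I_m -> R -> R),
    (forall j, is_composition q (E j)) /\
    D =1 (fun x => \sum_(j < m) a j * E j x).

Definition der_eq_Der q : Prop := forall D, der q D <-> Der q D.

End DiffOps.

Arguments der_eq_Der {k} R q.

Section WeightedIsolated.
Variables (k : fieldType) (n : nat).
Implicit Types (f g : {mpoly k[n]}) (x y : 'I_n -> k).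

Definition weighted_homogeneous f : Prop :=
  exists (w : 'I_n -> nat) (d : nat),
    [/\ forall i, (0 < w i)%N, (0 < d)%N &
        forall m : 'X_{1..n}, m \in msupp f -> (\sum_(i < n) w i * m i)%N = d].

Definition zariski_open (U : ('I_n -> k) -> Prop) : Prop :=
  exists S : {mpoly k[n]} -> Prop,
    forall x, U x <-> exists2 g, S g & g.@[x] != 0.

Definition isolated_point (Z : ('I_n -> k) -> Prop) x : Prop :=
  Z x /\
  exists U, [/\ zariski_open U, U x & forall y, U y -> Z y -> y =1 x].

Definition singular_zero f x : Prop :=
  f.@[x] = 0 /\ forall i, (mderiv i f).@[x] = 0.

Definition isolated_hypersurface_singularity f : Prop :=
  isolated_point (singular_zero f) (fun=> 0).

End WeightedIsolated.

(* In ring_quotient, [idealr_closed I] says that I is a proper ideal. *)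
Section Regular.
Implicit Types R L : comNzRingType.

Definition generated_by R (I : {pred R}) (d : nat) : Prop :=
  exists g : 'I_d -> R,
    forall x, x \in I <-> exists c : 'I_d -> R, x = \sum_(i < d) c i * g i.

Definition noetherian R : Prop :=
  forall I : {pred R}, idealr_closed I -> exists d, generated_by I d.

Definition prime_ideal R (I : {pred R}) : Prop :=
  idealr_closed I /\ prime_idealr_closed I.

Definition maximal_ideal R (I : {pred R}) : Prop :=
  idealr_closed I /\
  forall J : {pred R}, idealr_closed J -> {subset I <= J} -> J =i I.

Definition prime_chain R (l : nat) (c : nat -> {pred R}) : Prop :=
  (forall i, (i <= l)%N -> prime_ideal (c i)) /\
  (forall i, (i < l)%N ->
     {subset c i <= c i.+1} /\ exists2 x, x \in c i.+1 & x \notin c i).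

Definition krull_dim R (d : nat) : Prop :=
  (exists c : nat -> {pred R}, prime_chain d c) /\
  (forall l (c : nat -> {pred R}), prime_chain l c -> (l <= d)%N).

(* A Noetherian local ring is regular when its maximal ideal can be generated
   by as many elements as its Krull dimension. *)
Definition regular_local R : Prop :=
  noetherian R /\
  exists m : {pred R},
    [/\ maximal_ideal m,
        forall m' : {pred R}, maximal_ideal m' -> m' =i m &
        exists2 d, krull_dim R d & generated_by m d].

(* phi exhibits L as the localization of R at the prime ideal p; this
   determines L up to a unique isomorphism of R-algebras. *)
Definition is_localization R (p : {pred R}) L (phi : {rmorphism R -> L}) : Prop :=
  [/\ forall s, s \notin p -> exists u, phi s * u = 1,
      forall z, exists a s, s \notin p /\ z * phi s = phi a &
      forall a, phi a = 0 <-> exists2 s, s \notin p & s * a = 0].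

Definition regular R : Prop :=
  noetherian R /\
  forall p : {pred R}, prime_ideal p ->
    exists (L : comNzRingType) (phi : {rmorphism R -> L}),
      is_localization p phi /\ regular_local L.

End Regular.

(* pi presents A as the quotient k-algebra k[x_1, ..., x_n] / (f). *)
Definition is_quotient_by (k : fieldType) (n : nat) (f : {mpoly k[n]})
    (A : comAlgType k) (pi : {lrmorphism {mpoly k[n]} -> A}) : Prop :=
  (forall a, exists p, pi p = a) /\
  (forall p, pi p = 0 <-> exists q, p = q * f).

(* Main.v *)
(** The origin is a common zero of the partials [f_i], so (for [n > 0]) one has
    to produce a second order derivation of [A] outside [der^2]. Let [J] be the
    Jacobian ideal, [H] the Hessian and [E_i = w_i x_i], so that Euler's
    relation reads [H E = (d - w_i) f_i].

    An operator [D = sum a_ij d_i d_j - sum c_l d_l] with [a] symmetric descends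
    to [A] once [a df = f u] for some vector [u] and [D f = 0]. If [D] lies in
    [der^2], then [H u = 0] modulo [J]: a vector field [v] with [v f = e f]
    satisfies [H v = 0] modulo [J], as one sees by differentiating. On the other
    hand, Cramer's rule shows that for [u] a row of cofactors of [H] the tensor
    [u_i E_j] is symmetric modulo [J], so it extends to such a symbol [a]; and
    then [H u] has [det H] as an entry.

    It remains to see that [det H] is not in [J]. By the Nullstellensatz [J]
    contains [x_i^N]; writing [x^N = M df] and [df = C x] with [C] a rescaled
    Hessian, [det (M C)] is [prod x_i^(N-1)] modulo the [x_i^N], while [det M]
    multiplies [J] into the ideal of the [x_i^N]. *)

Require Import Defs.
From HB Require Import structures.
From mathcomp Require Import all_boot all_order all_algebra ring_quotient.
From mathcomp Require Import mpoly.
From mathcomp Require Import ring.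
From Stdlib Require Import Classical.

Set Implicit Arguments.
Unset Strict Implicit.
Unset Printing Implicit Defensive.

Import GRing.Theory.
Local Open Scope ring_scope.

(** * Transition determinants between ideals *)

Section PropIdeals.
Variable R : comNzRingType.

(** Ideals are [Prop]-valued because membership need not be decidable; the unit ideal is allowed. *)
Record is_ideal (I : R -> Prop) : Prop := IsIdeal {
  idl0 : I 0;
  idlD : forall x y, I x -> I y -> I (x + y);
  idlMl : forall a x, I x -> I (a * x) }.

Variables (I : R -> Prop) (hI : is_ideal I).

Lemma idlMr a x : I x -> I (x * a).
Proof. by rewrite mulrC; apply: (idlMl hI). Qed.

Lemma idlN x : I x -> I (- x).
Proof. by rewrite -mulN1r; apply: (idlMl hI). Qed.

Lemma idlB x y : I x -> I y -> I (x - y).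
Proof. by move=> Ix Iy; apply: (idlD hI) => //; apply: idlN. Qed.

Lemma idl_sum (T : Type) (r : seq T) (P : pred T) (F : T -> R) :
  (forall i, P i -> I (F i)) -> I (\sum_(i <- r | P i) F i).
Proof.
by move=> IF; elim/big_ind: _ => //; [exact: idl0 | exact: idlD].
Qed.

Lemma idl_eqmod x y : I (x - y) -> I y -> I x.
Proof. by move=> Ixy Iy; rewrite -(subrK y x); apply: (idlD hI). Qed.

End PropIdeals.

Definition gen_ideal (R : comNzRingType) n (g : 'I_n -> R) : R -> Prop :=
  fun x => exists c : 'I_n -> R, x = \sum_i c i * g i.

Lemma is_ideal_gen (R : comNzRingType) n (g : 'I_n -> R) :
  is_ideal (gen_ideal g).
Proof.
split.
- by exists (fun=> 0); rewrite big1 // => i _; rewrite mul0r.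
- move=> _ _ [c ->] [c' ->]; exists (fun i => c i + c' i).
  by rewrite -big_split; apply: eq_bigr => i _; rewrite mulrDl.
- move=> a _ [c ->]; exists (fun i => a * c i).
  by rewrite mulr_sumr; apply: eq_bigr => i _; rewrite mulrA.
Qed.

Lemma mem_gen_ideal (R : comNzRingType) n (g : 'I_n -> R) i : gen_ideal g (g i).
Proof.
exists (fun j => (j == i)%:R); rewrite (bigD1 i) //= eqxx mul1r big1 ?addr0 //.
by move=> j /negPf ->; rewrite mul0r.
Qed.

(** * Cofactors and Cramer's rule modulo an ideal *)

Section Cofactors.
Variables (R : comNzRingType) (n : nat).
Implicit Types (H : 'M[R]_n) (l : 'I_n).

Definition set_row H l (r : 'I_n -> R) : 'M[R]_n :=
  \matrix_(a, b) if a == l then r b else H a b.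

Lemma cofactor_set_row H l r j : cofactor (set_row H l r) l j = cofactor H l j.
Proof.
rewrite /cofactor; congr (_ * \det _).
by apply/matrixP=> a b; rewrite !mxE eq_sym (negPf (neq_lift _ _)).
Qed.

Lemma det_set_row H l r :
  \det (set_row H l r) = \sum_j r j * cofactor H l j.
Proof.
rewrite (expand_det_row _ l); apply: eq_bigr => j _.
by rewrite cofactor_set_row mxE eqxx.
Qed.

(* Cramer's rule for [H] with its row [l] replaced by a basis vector. *)
Lemma cofactor_exchange (I : R -> Prop) (x : 'I_n -> R) H l : is_ideal I ->
  (forall i, i != l -> I (\sum_j H i j * x j)) ->
  forall i j, I (cofactor H l i * x j - cofactor H l j * x i).
Proof.
move=> hI Hx i j.
pose K := set_row H l (fun b => (b == i)%:R).
have detK : \det K = cofactor H l i.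
  rewrite det_set_row (bigD1 i) //= eqxx mul1r big1 ?addr0 //.
  by move=> b /negPf ->; rewrite mul0r.
pose X : 'cV[R]_n := \col_b x b.
have : (\adj K *m (K *m X)) j 0 = cofactor H l i * x j.
  by rewrite mulmxA mul_adj_mx detK mul_scalar_mx !mxE.
rewrite mxE (bigD1 l) //= => <-.
have -> : \adj K j l = cofactor H l j by rewrite mxE cofactor_set_row.
have -> : (K *m X) l 0 = x i.
  rewrite mxE (bigD1 i) //= !mxE !eqxx mul1r big1 ?addr0 //.
  by move=> b /negPf nb; rewrite !mxE eqxx nb mul0r.
rewrite addrAC subrr add0r; apply: idl_sum => // a al; apply: (idlMl hI).
rewrite mxE (eq_bigr (fun b => H a b * x b)); first exact: Hx.
by move=> b _; rewrite !mxE (negPf al).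
Qed.

End Cofactors.

(** * Syzygies of the variables and ideals of their powers *)

Section Variables.
Variables (k : comNzRingType) (n : nat).
Local Notation P := {mpoly k[n]}.

(** One variable ['X_i] of the monomial is traded for [u i]. By [exponent_tailU] the choice of [i]
    is immaterial modulo the ideal; the constant monomial goes to [0]. *)
Definition exponent_tail (u : 'I_n -> P) (m : 'X_{1..n}) : P :=
  if [pick i | m i != 0%N] is Some i then 'X_[m - U_(i)] * u i else 0.

Lemma exponent_tailU (I : P -> Prop) (u : 'I_n -> P) m j : is_ideal I ->
  (forall i j, I (u i * 'X_j - u j * 'X_i)) ->
  I (exponent_tail u (m + U_(j)) - 'X_[m] * u j).
Proof.
move=> hI uX; rewrite /exponent_tail; case: pickP => [i|/(_ j)]; last first.
  by rewrite mnmDE mnm1E eqxx addn1.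
have [->|nij] := eqVneq i j.
  by rewrite addmK subrr => _; exact: idl0.
rewrite mnmDE mnm1E [j == i]eq_sym (negPf nij) addn0 => mi.
have {1 2}-> : m = (m - U_(i) + U_(i))%MM by rewrite submK // lep1mP.
rewrite -addmA [(U_(i) + _)%MM]addmC addmA addmK !mpolyXD.
have -> : 'X_[m - U_(i)] * 'X_j * u i - 'X_[m - U_(i)] * 'X_i * u j =
          'X_[m - U_(i)] * (u i * 'X_j - u j * 'X_i) :> P by ring.
exact: (idlMl hI).
Qed.

(* The linear map [x^m |-> exponent_tail u m] sends [x_j p] to [u_j p] modulo
   [I]; this replaces the exactness of the Koszul complex of the variables. *)
Lemma variable_syzygy (I : P -> Prop) (u c : 'I_n -> P) : is_ideal I ->
  (forall i j, I (u i * 'X_j - u j * 'X_i)) ->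
  \sum_j c j * 'X_j = 0 -> I (\sum_j c j * u j).
Proof.
move=> hI uX c0.
(* [B] exceeds the degree of every [c j * 'X_j]: [msize] is already above the degree of [c j], and
   the successor leaves room for the extra variable. *)
pose B := (\max_(j < n) msize (c j)).+1.
pose L (p : P) := \sum_(m : 'X_{1..n < B}) p@_m *: exponent_tail u m.
have LD p q : L (p + q) = L p + L q.
  by rewrite -big_split; apply: eq_bigr => m _; rewrite mcoeffD scalerDl.
have L0 : L 0 = 0 by rewrite /L big1 // => m _; rewrite mcoeff0 scale0r.
have LZ a p : L (a *: p) = a *: L p.
  by rewrite scaler_sumr; apply: eq_bigr => m _; rewrite mcoeffZ scalerA.
have Lsum (T : Type) (r : seq T) (F : T -> P) :
    L (\sum_(i <- r) F i) = \sum_(i <- r) L (F i).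
  by apply: (big_morph L LD L0).
have LX (m : 'X_{1..n}) : (mdeg m < B)%N -> L 'X_[m] = exponent_tail u m.
  move=> mB; rewrite /L (bigD1 (BMultinom mB)) //= mcoeffX eqxx scale1r.
  rewrite big1 ?addr0 // => m' nm'; rewrite mcoeffX eq_sym.
  have -> : (bmnm m' == m) = false.
    rewrite bmeqP in nm'.
    exact: negPf.
  by rewrite scale0r.
have Lc j : I (L (c j * 'X_j) - c j * u j).
  rewrite (mpolyE (c j)) !mulr_suml Lsum -sumrB big_seq.
  apply: idl_sum => // m mc; rewrite -!scalerAl LZ -scalerBr -mpolyXD.
  rewrite -mul_mpolyC LX; first by apply: (idlMl hI); exact: exponent_tailU.
  rewrite mdegD mdeg1 addn1 ltnS; apply: leq_trans (leq_bigmax j).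
  exact: msize_mdeg_lt.
have : I (\sum_j (L (c j * 'X_j) - c j * u j)) by apply: idl_sum.
by rewrite sumrB -Lsum c0 L0 sub0r => /(idlN hI); rewrite opprK.
Qed.

Definition power_ideal N : P -> Prop := gen_ideal (fun i : 'I_n => 'X_i ^+ N).

(** The rows of [C] are replaced one at a time by those of the diagonal matrix with entries
    ['X_i ^+ N]. The old and the new row have the same product with the vector of variables, so
    their difference is a syzygy, while the cofactors along that row satisfy the exchange relation
    modulo the powers. *)
Lemma det_transition N (C : 'M[P]_n) :
  (forall i, \sum_j C i j * 'X_j = 'X_i ^+ N.+1) ->
  power_ideal N.+1 (\det C - \prod_i 'X_i ^+ N).
Proof.
move=> CX; set I := power_ideal N.+1.
have hI : is_ideal I by apply: is_ideal_gen.
pose dg a (b : 'I_n) : P := if b == a then 'X_a ^+ N else 0.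
pose K s : 'M[P]_n := \matrix_(a, b) if (a < s)%N then dg a b else C a b.
have dgX a : \sum_j dg a j * 'X_j = 'X_a ^+ N.+1.
  rewrite (bigD1 a) //= /dg eqxx exprSr big1 ?addr0 // => b /negPf ->.
  by rewrite mul0r.
have KX s a : \sum_j K s a j * 'X_j = 'X_a ^+ N.+1.
  rewrite -(CX a) -[RHS](if_same (a < s)%N).
  case: ifP => as_; last by apply: eq_bigr => b _; rewrite mxE as_.
  by rewrite CX -(dgX a); apply: eq_bigr => b _; rewrite mxE as_.
have step (l : 'I_n) : I (\det (K l) - \det (K l.+1)).
  have -> : K l.+1 = set_row (K l) l (dg l).
    apply/matrixP=> a b; rewrite !mxE ltnS leq_eqVlt.
    by rewrite val_eqE; have [->|] := eqVneq a l; rewrite ?eqxx.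
  rewrite det_set_row (expand_det_row _ l) -sumrB.
  under eq_bigr => b _ do rewrite -mulrBl.
  apply: variable_syzygy => // [i j|].
    apply: (@cofactor_exchange _ _ I (fun i => 'X_i)) => // a _; rewrite KX.
    exact: (mem_gen_ideal (fun i => 'X_i ^+ N.+1)).
  under eq_bigr => b _ do rewrite mulrBl.
  by rewrite sumrB KX dgX subrr.
have all_steps s : (s <= n)%N -> I (\det C - \det (K s)).
  elim: s => [_|s IHs sn].
    have -> : K 0%N = C by apply/matrixP=> a b; rewrite mxE.
    by rewrite subrr; exact: idl0.
  rewrite -(subrKA (\det (K s))); apply: (idlD hI); first exact/IHs/ltnW.
  exact: (step (Ordinal sn)).
have -> : \prod_i 'X_i ^+ N = \det (K n); last exact: all_steps.
have -> : K n = diag_mx (\row_i 'X_i ^+ N).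
  apply/matrixP=> a b; rewrite !mxE ltn_ord /dg eq_sym.
  by case: eqP => [->|]; rewrite ?mulr1n ?mulr0n.
by rewrite det_diag; apply: eq_bigr => i _; rewrite mxE.
Qed.

(** Every monomial of a multiple of ['X_i ^+ N.+1] has exponent above [N] in ['X_i], so none of them
    is the corner monomial. *)
Lemma corner_notin_power_ideal N : ~ power_ideal N.+1 (\prod_i 'X_i ^+ N).
Proof.
pose m : 'X_{1..n} := [multinom N | i < n].
have -> : \prod_i 'X_i ^+ N = 'X_[m] :> P.
  by rewrite [RHS]mpolyXE_id; apply: eq_bigr => i _; rewrite mnmE.
case=> c /(congr1 (mcoeff m)); rewrite mcoeffX eqxx raddf_sum /= big1.
  by move/eqP; rewrite oner_eq0.
move=> i _; apply: memN_msupp_eq0; rewrite mpolyXn (perm_mem (msuppMX _ _)).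
apply/negP => /mapP[m' _ /mnmP/(_ i)].
rewrite mnmDE mulmnE mnm1E eqxx mnmE mul1n => e.
by have := leq_addr (m' i) N.+1; rewrite -e ltnn.
Qed.

(* With [X^(N+1) = M F], the determinant of [M C] is [prod X^N] modulo the
   powers, while [det M] carries [gen_ideal F] into them. *)
Lemma det_notin_gen_ideal N (F : 'I_n -> P) (C : 'M[P]_n) :
  (forall i, F i = \sum_j C i j * 'X_j) ->
  (forall i, gen_ideal F ('X_i ^+ N.+1)) -> ~ gen_ideal F (\det C).
Proof.
move=> FC FX [g detC].
have [M XM] := fin_all_exists FX.
pose Mx : 'M[P]_n := \matrix_(i, j) M i j.
have hI : is_ideal (power_ideal N.+1) by apply: is_ideal_gen.
apply: (@corner_notin_power_ideal N).
have MCX i : \sum_j (Mx *m C) i j * 'X_j = 'X_i ^+ N.+1.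
  rewrite XM; under eq_bigr => j _ do rewrite mxE mulr_suml.
  rewrite exchange_big; apply: eq_bigr => a _ /=; rewrite FC mulr_sumr.
  by apply: eq_bigr => b _; rewrite mxE mulrA.
have /(idlN hI) := det_transition MCX; rewrite opprB => /(idl_eqmod hI).
apply; rewrite det_mulmx detC mulr_sumr; apply: idl_sum => // i _.
rewrite mulrCA; apply: (idlMl hI).
pose Y : 'cV[P]_n := \col_a F a.
have -> : \det Mx * F i = (\adj Mx *m (Mx *m Y)) i 0.
  by rewrite mulmxA mul_adj_mx mul_scalar_mx !mxE.
rewrite mxE; apply: idl_sum => // a _; apply: (idlMl hI).
rewrite mxE (eq_bigr (fun b => M a b * F b)); last by move=> b _; rewrite !mxE.
by rewrite -XM; exact: mem_gen_ideal.
Qed.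

End Variables.

(** * Hilbert's Nullstellensatz *)

Section HornerIdeal.
Variables (R S : comNzRingType) (psi : {rmorphism R -> S}).
Variables (I : S -> Prop) (hI : is_ideal I) (D : nat) (M : 'M[R]_D.+1).
Variables (t : S) (e : 'I_D.+1 -> S).
Hypothesis eM : forall i, I (\sum_j psi (M i j) * e j - t * e i).

(** By [eM], [e] is an eigenvector of [M] with eigenvalue [t] modulo [I]; a polynomial in [M] then
    acts on [e] through its value at [t]. *)
Lemma horner_mx_eigen h i :
  I (\sum_j psi (horner_mx M h i j) * e j - (map_poly psi h).[t] * e i).
Proof.
elim/poly_ind: h i => [|p c IHp] i.
  rewrite !rmorph0 horner0 mul0r subr0 big1; first exact: idl0.
  by move=> j _; rewrite mxE rmorph0 mul0r.
rewrite rmorphD rmorphM /= horner_mx_X horner_mx_C rmorphD rmorphM /=.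
rewrite map_polyX map_polyC hornerD hornerMX hornerC.
set pt := _.[t].
have -> : \sum_j psi ((horner_mx M p * M + c%:M) i j) * e j =
    \sum_s psi (horner_mx M p i s) * (\sum_j psi (M s j) * e j) + psi c * e i.
  under [in RHS]eq_bigr => s _ do rewrite mulr_sumr.
  rewrite exchange_big /= [psi c * _](_ : _ = \sum_j psi (c *+ (i == j)) * e j).
    rewrite -big_split; apply: eq_bigr => j _ /=.
    rewrite -[_ * M]/(_ *m M) !mxE rmorphD rmorph_sum mulrDl mulr_suml.
    by congr (_ + _); apply: eq_bigr => s _; rewrite rmorphM mulrA.
  rewrite (bigD1 i) //= eqxx big1 ?addr0 // => j /negPf.
  by rewrite eq_sym => ->; rewrite rmorph0 mul0r.
rewrite [X in I X](_ : _ =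
  \sum_s psi (horner_mx M p i s) * (\sum_j psi (M s j) * e j - t * e s) +
  t * (\sum_s psi (horner_mx M p i s) * e s - pt * e i)); last first.
  under [in RHS]eq_bigr => s _ do rewrite mulrBr.
  have tE : \sum_s psi (horner_mx M p i s) * (t * e s) =
            t * \sum_s psi (horner_mx M p i s) * e s.
    by rewrite mulr_sumr; apply: eq_bigr => s _; rewrite mulrCA.
  by rewrite sumrB tE; ring.
apply: (idlD hI); last exact: (idlMl hI).
by apply: idl_sum => // s _; apply: (idlMl hI).
Qed.

(** Modulo [I] the matrix [h(M)] kills [e]; multiplying by the adjugate, its determinant kills the
    entry [e ord0 = 1]. *)
Lemma det_horner_mx_ideal h : e ord0 = 1 ->
  I ((map_poly psi h).[t]) -> I (psi (\det (horner_mx M h))).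
Proof.
move=> e0 Ih; set N := horner_mx M h.
have IN i : I (\sum_j psi (N i j) * e j).
  by apply: (idl_eqmod hI (horner_mx_eigen h i)); exact: (idlMr hI).
pose E : 'cV[S]_D.+1 := \col_j e j.
have detE : (map_mx psi (\adj N) *m (map_mx psi N *m E)) ord0 0 = psi (\det N).
  rewrite mulmxA -map_mxM mul_adj_mx map_scalar_mx mul_scalar_mx !mxE e0.
  by rewrite mulr1.
suff : I ((map_mx psi (\adj N) *m (map_mx psi N *m E)) ord0 0) by rewrite detE.
rewrite mxE; apply: idl_sum => // i _; apply: (idlMl hI).
by rewrite mxE (eq_bigr (fun j => psi (N i j) * e j)) // => j _; rewrite !mxE.
Qed.

End HornerIdeal.

(** For [g] monic of degree [D.+1], the rows express multiplication by [t] on [1, t, ..., t^D]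
    modulo [g(t)]. *)
Definition companion (R : nzRingType) D (g : {poly R}) : 'M[R]_D.+1 :=
  \matrix_(i, j) if (i < D)%N then (j == i.+1 :> nat)%:R else - g`_j.

(* The determinant trick (Nakayama) for the finite extension defined by [g]. *)
Lemma companion_ideal (R S : comNzRingType) (psi : {rmorphism R -> S})
    (I : S -> Prop) (hI : is_ideal I) D (g h : {poly R}) t :
  g \is monic -> size g = D.+2 ->
  I ((map_poly psi g).[t]) -> I ((map_poly psi h).[t]) ->
  I (psi (\det (horner_mx (companion D g) h))).
Proof.
move=> mg sg Ig Ih.
apply: (@det_horner_mx_ideal _ _ _ _ hI _ _ t (fun j => t ^+ j)) => // i.
have [iD|] := ltnP i D.
  have iD1 : (i.+1 < D.+1)%N by [].
  rewrite (bigD1 (Ordinal iD1)) //= mxE iD eqxx rmorph1 mul1r -exprS big1.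
    by rewrite addr0 subrr; exact: idl0.
  move=> j nj; rewrite mxE iD; have -> : (j == i.+1 :> nat) = false.
    exact: (negPf nj).
  by rewrite rmorph0 mul0r.
move=> Di; have iE : i = D :> nat by apply/eqP; rewrite eqn_leq -ltnS ltn_ord.
rewrite -exprS iE; have -> : \sum_j psi (companion D g i j) * t ^+ j - t ^+ D.+1
    = - (map_poly psi g).[t]; last exact: (idlN hI).
rewrite (@horner_coef_wide _ D.+2); last first.
  by rewrite -sg; exact: size_poly.
rewrite [in RHS]big_ord_recr /= opprD coef_map /=.
have -> : g`_D.+1 = 1 by move/monicP: mg; rewrite /lead_coef sg.
rewrite rmorph1 mul1r; congr (_ - _); rewrite -sumrN; apply: eq_bigr => j _.
by rewrite mxE ltnNge Di /= rmorphN coef_map mulNr.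
Qed.

(** Euclidean descent: an element of [K] that fails to divide another one is replaced by the
    remainder. An element dividing all of [K] is not constant, since [1] is outside [K], and so has
    a root. *)
Lemma poly_ideal_root (k : closedFieldType) (K : {poly k} -> Prop) q :
  is_ideal K -> K q -> q != 0 -> ~ K 1 -> exists b, forall h, K h -> root h b.
Proof.
move=> hK Kq q0 K1; have [m] := ubnP (size q).
elim: m q Kq q0 => // m IHm q Kq q0; rewrite ltnS => qm.
have [divq|] := classic (forall h, K h -> q %| h).
  have /closed_rootP[b qb] : size q != 1.
    apply/negP => /size_poly1P[c c0 qE]; apply: K1.
    have -> : 1 = c^-1%:P * q by rewrite qE -polyCM mulVf.
    exact: (idlMl hK).
  by exists b => h /divq/root_dvdp; apply.
move=> /not_all_ex_not[h] /(imply_to_and (K h))[Kh nqh].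
apply: (IHm (h %% q)).
- have -> : h %% q = h - h %/ q * q.
    by rewrite {2}(divp_eq h q) addrAC subrr add0r.
  by apply: (idlB hK) => //; apply: (idlMl hK).
- by apply/negP => /eqP/modp_eq0P.
- by apply: leq_trans qm; rewrite ltn_modp.
Qed.

(** * Substitution into multivariate polynomials *)

Section Mmap.
Variables (k : comNzRingType) (n : nat).

Lemma rmorph_mmap (S T : comNzRingType) (theta : {rmorphism S -> T})
    (f : {rmorphism k -> S}) (h : 'I_n -> S) (p : {mpoly k[n]}) :
  theta (mmap f h p) = mmap (theta \o f) (theta \o h) p.
Proof.
rewrite /mmap rmorph_sum; apply: eq_bigr => m _; rewrite rmorphM /=.
by congr (_ * _); rewrite rmorph_prod; apply: eq_bigr => i _; rewrite rmorphXn.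
Qed.

Lemma mmap_id (p : {mpoly k[n]}) :
  mmap (@mpolyC n k) (fun i => 'X_i) p = p.
Proof.
rewrite [RHS]mpolyE; apply: eq_bigr => m _.
by rewrite mmap1_id mul_mpolyC.
Qed.

Lemma eq_mmap (S : comNzRingType) (f f' : k -> S) (h h' : 'I_n -> S) :
  f =1 f' -> h =1 h' -> forall p : {mpoly k[n]}, mmap f h p = mmap f' h' p.
Proof.
move=> ff hh p; rewrite /mmap; apply: eq_bigr => m _; rewrite ff.
by congr (_ * _); apply: eq_bigr => i _; rewrite hh.
Qed.

End Mmap.

(** Uniqueness of base [B] digits keeps distinct monomials at distinct degrees under Nagata's
    substitution. *)
Lemma digits_inj B n (m m' : 'I_n -> nat) :
  (forall i, m i < B)%N -> (forall i, m' i < B)%N ->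
  (\sum_(i < n) m i * B ^ i = \sum_(i < n) m' i * B ^ i)%N -> m =1 m'.
Proof.
elim: n m m' => [|n IHn] m m' mB m'B; first by move=> _ [].
rewrite !big_ord_recl !expn0 !muln1.
have shift (u : 'I_n.+1 -> nat) :
    (\sum_(i < n) u (lift ord0 i) * B ^ lift ord0 i =
     (\sum_(i < n) u (lift ord0 i) * B ^ i) * B)%N.
  by rewrite big_distrl; apply: eq_bigr => i _; rewrite /= expnSr mulnA.
have B0 : (0 < B)%N by apply: leq_ltn_trans (mB ord0).
rewrite !shift => e.
have e0 : m ord0 = m' ord0.
  move/(congr1 (modn^~ B)): e.
  by rewrite ![(_ + _ * B)%N]addnC !modnMDl !modn_small.
move/eqP: e; rewrite e0 eqn_add2l eqn_pmul2r // => /eqP/IHn e i.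
by case: (unliftP ord0 i) => [j|] -> //; apply: e.
Qed.

Lemma seq_argmax (T : eqType) (s : seq T) (F : T -> nat) x : x \in s ->
  exists2 y, y \in s & forall z, z \in s -> (F z <= F y)%N.
Proof.
elim: s x => // a s IHs x _; case: s IHs => [_|b s IHs].
  by exists a => [|z]; rewrite inE // => /eqP ->.
have [y ys ymax] := IHs b (mem_head _ _).
have [ya|ay] := leqP (F y) (F a).
  exists a => [|z]; rewrite inE ?eqxx // => /orP[/eqP -> //|/ymax zy].
  exact: leq_trans ya.
exists y => [|z]; first by rewrite inE ys orbT.
by rewrite inE => /orP[/eqP ->|/ymax //]; apply: ltnW.
Qed.

(** * Nagata's change of variables *)

Section Nagata.
Variables (k : fieldType) (n : nat).
Local Notation R := {mpoly k[n]}.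

(* Nagata's substitution [x_i |-> x_i + T^(B^i)], [x_0 |-> T]. *)
Definition nagata_var B (i : 'I_n.+1) : {poly R} :=
  'X^(B ^ i) + (if unlift ord0 i is Some j then ('X_j)%:P else 0).

Definition nagata B : {mpoly k[n.+1]} -> {poly R} :=
  mmap (polyC \o @mpolyC n k) (nagata_var B).

(** The image of [x^m] is monic in [T], of degree the number with base [B.+1] digits [m i]. Hence a
    single monomial of [p] dominates, and the leading coefficient is its scalar coefficient. *)
Lemma nagata_monic B (p : {mpoly k[n.+1]}) : p != 0 ->
  (forall m, m \in msupp p -> forall i, m i < B.+1)%N ->
  exists2 c, c != 0 & c%:MP *: nagata B.+1 p \is monic.
Proof.
move=> p0 pB.
pose wt (m : 'X_{1..n.+1}) := (\sum_(i < n.+1) m i * B.+1 ^ i)%N.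
have var_monic i : nagata_var B.+1 i \is monic /\
    size (nagata_var B.+1 i) = (B.+1 ^ i).+1.
  pose r : {poly R} := if unlift ord0 i is Some j then ('X_j)%:P else 0.
  have s1 : (size r < size ('X^(B.+1 ^ i) : {poly R}))%N.
    rewrite size_polyXn ltnS /r.
    case: unlift => [j|]; last by rewrite size_poly0.
    by apply: leq_trans (size_polyC_leq1 _) _; rewrite expn_gt0.
  rewrite /nagata_var; split; last by rewrite size_polyDl // size_polyXn.
  by rewrite monicE lead_coefDl // lead_coefXn.
have mon_monic (m : 'X_{1..n.+1}) :
    mmap1 (nagata_var B.+1) m \is monic /\
    size (mmap1 (nagata_var B.+1) m) = (wt m).+1.
  rewrite /mmap1 /wt; apply: (big_rec2 (fun (p : {poly R}) s =>
    p \is monic /\ size p = s.+1)); first by rewrite monic1 size_poly1.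
  move=> i s q _ [mq sq]; have [mv sv] := var_monic i.
  have mvX : nagata_var B.+1 i ^+ m i \is monic by apply: monic_exp.
  split; first exact: rpredM.
  have svX : size (nagata_var B.+1 i ^+ m i) = (m i * B.+1 ^ i).+1.
    by rewrite (polySpred (monic_neq0 mvX)) size_exp sv mulnC.
  by rewrite size_monicM ?monic_neq0 // svX sq addSn addnS.
have [m0 m0p] : exists m0, m0 \in msupp p.
  case E: (msupp p) => [|m0 s]; first by rewrite (msuppnil0 E) eqxx in p0.
  by exists m0; rewrite mem_head.
have [m mp mmax] := seq_argmax wt m0p.
have coefE i : (nagata B.+1 p)`_i =
    \sum_(m' <- msupp p) (p@_m')%:MP * (mmap1 (nagata_var B.+1) m')`_i.
  rewrite coef_sum; apply: eq_bigr => m' _; exact: coefCM.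
have lead : (nagata B.+1 p)`_(wt m) = (p@_m)%:MP.
  rewrite coefE (bigD1_seq m) ?msupp_uniq //= big_seq_cond big1 ?addr0.
    have [/monicP + sm] := mon_monic m.
    by rewrite /lead_coef sm /= => ->; rewrite mulr1.
  move=> m' /andP[m'p nm]; have [_ sm'] := mon_monic m'.
  rewrite nth_default ?mulr0 // sm' ltn_neqAle mmax // andbT.
  apply: contra nm => /eqP/(digits_inj (pB _ m'p) (pB _ mp)) mm.
  by apply/eqP/mnmP.
have size_le : (size (nagata B.+1 p) <= (wt m).+1)%N.
  apply/leq_sizeP => i mi; rewrite coefE big_seq big1 // => m' m'p.
  have [_ sm'] := mon_monic m'; rewrite nth_default ?mulr0 // sm'.
  by apply: leq_ltn_trans mi; exact: mmax.
have pm0 : p@_m != 0 by rewrite -mcoeff_msupp.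
have size_eq : size (nagata B.+1 p) = (wt m).+1.
  apply/eqP; rewrite eqn_leq size_le /= ltnNge; apply/negP => s_le.
  have := nth_default 0 s_le; rewrite lead => /eqP.
  by rewrite mpolyC_eq0 (negPf pm0).
exists (p@_m)^-1; first by rewrite invr_eq0.
rewrite monicE lead_coefZ /lead_coef size_eq lead -mpolyCM mulVf //.
Qed.

End Nagata.

(** Induction on [n], with [S] arbitrary so that only the elements [a] change. A nonzero relation is
    made monic in [t = a ord0]; the induction hypothesis gives all coordinates but one, and a root
    in [k] gives the last. *)
Lemma weak_nullstellensatz (k : closedFieldType) n (S : comNzRingType)
    (iota : {rmorphism k -> S}) (I : S -> Prop) (a : 'I_n -> S) :
  is_ideal I -> ~ I 1 ->
  exists v : 'I_n -> k,
    forall p : {mpoly k[n]}, I (mmap iota a p) -> p.@[v] = 0.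
Proof.
move=> hI I1; elim: n a => [|n IHn] a.
  exists (fun=> 0) => p; rewrite (nvar0_mpolyC p) mmapC mevalC => Ic.
  apply/eqP/negP => /negP c0; apply: I1.
  rewrite -(rmorph1 iota) -(mulVf c0) rmorphM; exact: (idlMl hI).
have [[p0 [p00 Ip0]]|noI] :=
  classic (exists p, p != 0 /\ I (mmap iota a p)); last first.
  exists (fun=> 0) => p Ip; case: (eqVneq p 0) => [->|p0]; first exact: meval0.
  by case: noI; exists p.
pose B := msize p0.
have p0B (m : 'X_{1..n.+1}) : m \in msupp p0 -> forall i, (m i < B.+1)%N.
  move=> mp i; rewrite ltnS; apply: leq_trans (ltnW (msize_mdeg_lt mp)).
  by rewrite mdegE (bigD1 i) //= leq_addr.
have [c c0 mon] := nagata_monic p00 p0B.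
pose t := a ord0.
(* [a'] undoes the substitution: evaluating [nagata B.+1 p] at [a'] and [t] returns
   [mmap iota a p]. *)
pose a' (j : 'I_n) := a (lift ord0 j) - t ^+ (B.+1 ^ lift ord0 j).
have [v' v'P] := IHn a'.
pose psi : {rmorphism {mpoly k[n]} -> S} := mmap iota a'.
pose ev (q : {poly {mpoly k[n]}}) := (map_poly psi q).[t].
have evE p : ev (nagata B.+1 p) = mmap iota a p.
  rewrite /ev -[X in X.[t]]/(map_poly psi _).
  pose theta : {rmorphism {poly {mpoly k[n]}} -> S} :=
    horner_eval t \o map_poly psi.
  have -> : (map_poly psi (nagata B.+1 p)).[t] = theta (nagata B.+1 p) by [].
  rewrite rmorph_mmap; apply: eq_mmap => [x|i] /=.
    by rewrite map_polyC /= mmapC horner_evalE hornerC.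
  rewrite rmorphD /= rmorphXn /= map_polyX horner_evalE hornerD hornerXn.
  case: unliftP => [j|] ->; last by rewrite rmorph0 horner0 addr0 expn0 expr1.
  by rewrite map_polyC hornerC /= mmapX mmap1U addrC subrK.
have evD q r : ev (q + r) = ev q + ev r by rewrite /ev rmorphD hornerD.
have evM q r : ev (q * r) = ev q * ev r by rewrite /ev rmorphM hornerM.
pose ev' : {poly {mpoly k[n]}} -> {poly k} := map_poly (meval v').
(* The relations in [T], specialised at [v'], form an ideal of [k[T]]; a common root is the missing
   coordinate. *)
pose K (q : {poly k}) := exists2 h, I (ev h) & ev' h = q.
have hK : is_ideal K.
  split.
  - by exists 0; [rewrite /ev rmorph0 horner0; exact: idl0 | exact: rmorph0].
  - move=> _ _ [q Iq <-] [r Ir <-]; exists (q + r); last exact: rmorphD.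
    by rewrite evD; exact: (idlD hI).
  - move=> q _ [r Ir <-]; exists (map_poly (@mpolyC n k) q * r).
      by rewrite evM; exact: (idlMl hI).
    rewrite [LHS]rmorphM; congr (_ * _); apply/polyP=> i.
    by rewrite !coef_map /= mevalC.
pose g := c%:MP *: nagata B.+1 p0.
have Ig : I (ev g).
  by rewrite /g -mul_polyC evM evE; exact: (idlMl hI).
have evg_monic : ev' g \is monic by apply: monic_map.
have [] := @poly_ideal_root k K (ev' g) hK.
- by exists g.
- exact: monic_neq0.
(* If [h] specialises to [1], so does its companion determinant; but that determinant lies in the
   contraction of [I], hence vanishes at [v']. *)
- case=> h Ih h1; case sg: (size g) => [|[|D]].
  + by move/eqP: sg; rewrite size_poly_eq0 (negPf (monic_neq0 mon)).
  + move: Ig; have -> : g = 1.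
      have /eqP/size_poly1P[x _ gE] := sg; move/monicP: mon.
      by rewrite -/g gE lead_coefC => ->.
    by rewrite /ev rmorph1 hornerC.
  have := v'P _ (companion_ideal hI mon sg Ig Ih).
  rewrite -det_map_mx map_horner_mx.
  rewrite [X in horner_mx _ X](_ : _ = 1); last exact: h1.
  by rewrite rmorph1 det1 => /eqP; rewrite oner_eq0.
move=> b Kb; pose v (i : 'I_n.+1) :=
  b ^+ (B.+1 ^ i) + (if unlift ord0 i is Some j then v' j else 0).
exists v => p Ip; have /rootP : root (ev' (nagata B.+1 p)) b.
  by apply: Kb; exists (nagata B.+1 p); rewrite ?evE.
pose theta : {rmorphism {poly {mpoly k[n]}} -> k} :=
  horner_eval b \o map_poly (meval v').
have -> : (ev' (nagata B.+1 p)).[b] = theta (nagata B.+1 p) by [].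
rewrite rmorph_mmap => <-; apply: eq_mmap => [x|i] /=.
  by rewrite map_polyC /= mevalC horner_evalE hornerC.
rewrite rmorphD /= rmorphXn /= map_polyX horner_evalE hornerD hornerXn /v.
case: unlift => [j|]; last by rewrite rmorph0 horner0.
by rewrite map_polyC hornerC /= mevalXU.
Qed.

(* Rabinowitsch: apply the weak form in [P[T]] to [J] and [1 - x_j T]; comparing
   coefficients of powers of [T] in [1 = (1 - x_j T) h] modulo [J] gives
   [x_j^s] in [J]. *)
Lemma variable_power_mem (k : closedFieldType) n (J : {mpoly k[n]} -> Prop) j :
  is_ideal J ->
  (forall v, (forall p, J p -> p.@[v] = 0) -> v j = 0) ->
  exists N, J ('X_j ^+ N).
Proof.
move=> hJ Jv; apply: NNPP => noN.
(* The ideal generated by [J] and [1 - 'X_j T]; membership in [J[T]] is tested on coefficients. *)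
pose I (q : {poly {mpoly k[n]}}) := exists h : {poly {mpoly k[n]}},
  forall s, J (q - (1 - 'X_j *: 'X) * h)`_s.
have hI : is_ideal I.
  split.
  - by exists 0 => s; rewrite mulr0 subrr coef0; exact: idl0.
  - move=> q r [h Ih] [h' Ih']; exists (h + h') => s.
    by rewrite mulrDr opprD addrACA coefD; exact: (idlD hJ).
  - move=> q r [h Ih]; exists (q * h) => s.
    rewrite mulrCA -mulrBr coefM; apply: idl_sum => // i _; exact: (idlMl hJ).
have I1 : ~ I 1.
  case=> h hP; apply: noN; exists (size h).
  have hs s : J (h`_s - 'X_j ^+ s).
    elim: s => [|s IHs].
      have := hP 0%N; rewrite mulrBl mul1r -scalerAl !coefB coefZ coefXM mulr0.
      by rewrite subr0 expr0 coef1 => /(idlN hJ); rewrite opprB.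
    have := hP s.+1; rewrite mulrBl mul1r -scalerAl !coefB coefZ coefXM coef1.
    rewrite sub0r opprB /= => /(idlN hJ); rewrite opprB => /(idlD hJ).
    move=> /(_ _ (idlMl hJ 'X_j IHs)).
    by rewrite mulrBr addrA subrK exprS.
  have := hs (size h).
  by rewrite nth_default // sub0r => /(idlN hJ); rewrite opprK.
pose a (i : 'I_n.+1) : {poly {mpoly k[n]}} :=
  if unlift ord0 i is Some l then ('X_l)%:P else 'X.
have [v vP] := @weak_nullstellensatz k n.+1 _ (polyC \o @mpolyC n k) I a hI I1.
pose up : {mpoly k[n]} -> {mpoly k[n.+1]} :=
  mmap (@mpolyC n.+1 k) (fun i => 'X_(lift ord0 i)).
have mmap_up p : mmap (polyC \o @mpolyC n k) a (up p) = p%:P.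
  rewrite rmorph_mmap -[in RHS](mmap_id p) [in RHS]rmorph_mmap.
  apply: eq_mmap => [x|i] /=; first by rewrite mmapC.
  by rewrite mmapX mmap1U /a liftK.
pose w i := v (lift ord0 i).
have w_zero p : J p -> p.@[w] = 0.
  move=> Jp; have <- : (up p).@[v] = p.@[w].
    rewrite rmorph_mmap; apply: eq_mmap => [x|i] /=; first exact: mevalC.
    by rewrite mevalXU.
  apply: vP; rewrite mmap_up; exists 0 => s; rewrite mulr0 subr0 coefC.
  by case: eqP => // _; exact: idl0.
(* The value at [v] is [0] because [1 - 'X_j T] lies in [I], yet it is [1] because [w] is a zero of
   [J] and so [w j = 0]. *)
have /eqP : (1 - 'X_(lift ord0 j) * 'X_ord0).@[v] = 0.
  apply: vP; rewrite rmorphB rmorph1 rmorphM /= !mmapX !mmap1U /a liftK.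
  rewrite unlift_none; exists 1 => s.
  by rewrite mulr1 mul_polyC subrr coef0; exact: idl0.
rewrite mevalB meval1 mevalM !mevalXU -/(w j) (Jv w w_zero) mul0r subr0.
by rewrite oner_eq0.
Qed.

(** * The Hessian of a weighted homogeneous polynomial *)

Definition hessian (k : comNzRingType) n (f : {mpoly k[n]}) :
  'M[{mpoly k[n]}]_n :=
  \matrix_(i, j) f^`M(i)^`M(j).

Section WeightedHomogeneous.
Variables (k : fieldType) (n : nat) (w : 'I_n -> nat) (d : nat).
Local Notation P := {mpoly k[n]}.
Implicit Types (f p : P) (m : 'X_{1..n}).

Definition weight m : nat := (\sum_(i < n) w i * m i)%N.

Definition homogeneous f : Prop := forall m, m \in msupp f -> weight m = d.

Lemma euler f : homogeneous f ->
  \sum_i (w i)%:R *: ('X_i * f^`M(i)) = d%:R *: f.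
Proof.
move=> hf; rewrite [f in RHS]mpolyE scaler_sumr.
under eq_bigr => i _.
  rewrite [f in f^`M(i)]mpolyE raddf_sum mulr_sumr scaler_sumr; over.
rewrite exchange_big big_seq [RHS]big_seq; apply: eq_bigr => m mf /=.
rewrite -(hf m mf) /weight natr_sum scaler_suml; apply: eq_bigr => i _.
rewrite mderivZ mderivX -!scalerAr !scalerA natrM.
have [->|mi] := posnP (m i); first by rewrite !(mulr0, mul0r) !scale0r.
rewrite -mpolyXD addmC submK ?lep1mP -?lt0n //.
by congr (_ *: _); rewrite mulrAC mulrA.
Qed.

Lemma euler_deriv f i : homogeneous f ->
  \sum_j (w j)%:R *: ('X_j * f^`M(i)^`M(j)) = (d%:R - (w i)%:R) *: f^`M(i).
Proof.
move=> hf; have /(congr1 (mderiv i)) := euler hf.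
rewrite raddf_sum /= mderivZ scalerBl => <-.
under [X in X - _]eq_bigr => j _ do
  rewrite mderivZ mderivM mderivX mnm1E mderiv_comm scalerDr.
rewrite big_split /= [X in _ = X + _ - _](bigD1 i) //=.
rewrite [X in _ = _ + X + _ - _]big1.
  have -> : (U_(i) - U_(i) = 0)%MM by apply/mnmP=> j; rewrite mnmBE subnn mnm0E.
  by rewrite eqxx scale1r mpolyX0 mul1r addr0 addrAC subrr add0r.
by move=> j /negPf ->; rewrite scale0r mul0r scaler0.
Qed.

(** [f_i] is weighted homogeneous of degree [d - w i]; the factor [t ^+ w i] avoids a truncated
    subtraction in the exponent. *)
Lemma meval_weighted f (t : k) (y : 'I_n -> k) i : homogeneous f ->
  t ^+ w i * f^`M(i).@[fun j => t ^+ w j * y j] = t ^+ d * f^`M(i).@[y].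
Proof.
move=> hf.
have -> : f^`M(i) =
    \sum_(m <- msupp f) f@_m *: ((m i)%:R *: 'X_[m - U_(i)]).
  rewrite {1}[f]mpolyE raddf_sum; apply: eq_bigr => m _ /=.
  by rewrite mderivZ mderivX.
rewrite !raddf_sum !mulr_sumr big_seq [RHS]big_seq; apply: eq_bigr => m mf /=.
rewrite !mevalZ !mevalX.
have [->|mi] := posnP (m i); first by rewrite !(mul0r, mulr0).
rewrite mulrCA [RHS]mulrCA; congr (_ * _); rewrite mulrCA [RHS]mulrCA.
congr (_ * _); under eq_bigr => j _ do rewrite exprMn -exprM.
rewrite big_split /= mulrA; congr (_ * _).
rewrite prodrXr -exprD; congr (_ ^+ _).
rewrite -(hf m mf) /weight (bigD1 i) //= [RHS](bigD1 i) //=.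
rewrite mnmBE mnm1E eqxx addnA -mulnS subn1 prednK //; congr (_ + _)%N.
by apply: eq_bigr => j /negPf nj; rewrite mnmBE mnm1E eq_sym nj subn0.
Qed.

End WeightedHomogeneous.

(** * The critical locus of an isolated singularity *)

Section IsolatedZero.
Variables (k : closedFieldType) (n : nat).
Local Notation P := {mpoly k[n]}.

(** The zeros of the partials are stable under the weighted action of [t] on [y]. A polynomial
    nonzero at the origin stays nonzero on the orbit for some [t != 0]; there Euler's relation gives
    [f = 0], so isolation sends this point, and hence [y], to the origin. *)
Lemma common_zero_origin (w : 'I_n -> nat) d (f : P) : [pchar k] =i pred0 ->
  (forall i, 0 < w i)%N -> (0 < d)%N -> homogeneous w d f ->
  isolated_hypersurface_singularity f ->
  forall y, (forall i, f^`M(i).@[y] = 0) -> y =1 (fun=> 0).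
Proof.
move=> /pcharf0P hchar w0 d0 hf [_ [U [[S US] U0 Uy]]] y fy.
have [g Sg g0] := (US _).1 U0.
pose q : {poly k} := mmap polyC (fun i => y i *: 'X^(w i)) g.
have qE t : q.[t] = g.@[fun i => t ^+ w i * y i].
  rewrite -horner_evalE rmorph_mmap; apply: eq_mmap => [x|i] /=.
    by rewrite horner_evalE hornerC.
  by rewrite horner_evalE hornerZ hornerXn mulrC.
have q0 : q != 0.
  apply: contraNneq g0 => q0; have <- : q.[0] = g.@[fun=> 0].
    by rewrite qE; apply: meval_eq => i; rewrite expr0n gtn_eqF // mul0r.
  by rewrite q0 horner0.
(* The factor ['X] rules out [t = 0] along with the roots of [q]. *)
have /closed_nonrootP[t] : 'X * q != 0 by rewrite mulf_neq0 ?polyX_eq0.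
rewrite rootE hornerM hornerX mulf_eq0 negb_or => /andP[t0 qt].
pose ty i := t ^+ w i * y i.
have fty i : f^`M(i).@[ty] = 0.
  have /eqP := meval_weighted t y i hf; rewrite fy mulr0.
  by rewrite mulf_eq0 expf_eq0 (negPf t0) andbF => /eqP.
have : ty =1 fun=> 0.
  apply: Uy; first by apply/US; exists g => //; rewrite -qE.
  split => //; apply/eqP; have /eqP := congr1 (meval ty) (euler hf).
  rewrite raddf_sum big1 => [|i _]; last by rewrite /= mevalZ mevalM fty !mulr0.
  by rewrite eq_sym mevalZ mulf_eq0 hchar gtn_eqF.
move=> ty0 i; have /eqP := ty0 i.
by rewrite mulf_eq0 expf_eq0 (negPf t0) andbF => /eqP.
Qed.

(** Here [f_i] has weighted degree [0], and positive weights leave only constants. *)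
Lemma linear_weight_deriv (w : 'I_n -> nat) d (f : P) i :
  (forall i, 0 < w i)%N -> homogeneous w d f -> w i = d ->
  f^`M(i).@[fun=> 0] = 0 -> f^`M(i) = 0.
Proof.
move=> w0 hf wi; set g := f^`M(i) => g0.
have gC : g = (g@_0)%:MP.
  apply/mpolyP => m; rewrite mcoeffC; have [->|m0] := eqVneq m 0%MM.
    by rewrite mulr1.
  rewrite mulr0; apply/eqP; rewrite mcoeff_eq0; apply: contra m0 => mg.
  have : (m + U_(i))%MM \in msupp f.
    move: mg; rewrite !mcoeff_msupp /g mcoeff_mderiv; apply: contraNneq => ->.
    by rewrite mul0rn.
  have wi_sum : (\sum_j w j * (i == j))%N = w i.
    rewrite (bigD1 i) //= eqxx muln1 big1 ?addn0 // => j /negPf.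
    by rewrite eq_sym => ->; rewrite muln0.
  move/hf; rewrite -wi /weight (eq_bigr (fun j => w j * m j + w j * (i == j)))%N.
    rewrite big_split /= wi_sum => /eqP.
    rewrite -{2}[w i]add0n eqn_add2r sum_nat_eq0 => /forallP mw.
    apply/eqP/mnmP => j; rewrite mnm0E.
    by have := mw j; rewrite /= muln_eq0 eqn0Ngt w0 => /eqP.
  by move=> j _; rewrite mnmDE mnm1E mulnDr.
by move: g0; rewrite gC mevalC => ->; rewrite mpolyC0.
Qed.

Lemma det_hessian_notin (f : P) : [pchar k] =i pred0 ->
  weighted_homogeneous f -> isolated_hypersurface_singularity f ->
  ~ gen_ideal (fun i => f^`M(i)) (\det (hessian f)).
Proof.
move=> hchar [w [d [w0 d0 hf]]] iso.
pose F i := f^`M(i); rewrite -[gen_ideal _]/(gen_ideal F).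
have hJ : is_ideal (gen_ideal F) by apply: is_ideal_gen.
have powers j : exists N, gen_ideal F ('X_j ^+ N).
  apply: variable_power_mem => // v vJ.
  apply: (common_zero_origin hchar w0 d0 hf iso) => i.
  by apply: vJ; exact: mem_gen_ideal.
have [N NP] := fin_all_exists powers.
(* The scaling turns Euler's relation into [F = C x]. If [d = w i], the inverse takes its default
   value, which is harmless because [F i] is then zero. *)
pose C : 'M[P]_n := \matrix_(i, j)
  ((d%:R - (w i)%:R)^-1 *: ((w j)%:R *: f^`M(i)^`M(j))).
have FC i : F i = \sum_j C i j * 'X_j.
  under eq_bigr => j _ do rewrite mxE -!scalerAl mulrC.
  rewrite -scaler_sumr (euler_deriv i hf) scalerA.
  have [e|] := eqVneq (d%:R - (w i)%:R : k) 0; last first.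
    by move/mulVf => ->; rewrite scale1r.
  rewrite /F (@linear_weight_deriv w d f i) ?scaler0 //.
    move/pcharf0P in hchar; apply/eqP; rewrite eqn_leq.
    have [wd|dw] := leqP (w i) d.
      by rewrite /= -subn_eq0 -hchar natrB // e.
    move/eqP: e; rewrite -oppr_eq0 opprB -natrB 1?ltnW // hchar subn_eq0.
    by rewrite leqNgt dw.
  by have [[_ ->] _] := iso.
(* The sum of the [N j] provides one exponent for all variables. As [C] is the Hessian between two
   diagonal matrices, [\det C] is a multiple of the Hessian determinant. *)
apply: contra_not (@det_notin_gen_ideal _ _ (\sum_j N j)%N F C FC _) => [detH|j].
  have -> : C = diag_mx (\row_i ((d%:R - (w i)%:R)^-1)%:MP) *m hessian f
                *m diag_mx (\row_j ((w j)%:R)%:MP).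
    apply/matrixP => i j; rewrite mul_mx_diag mul_diag_mx !mxE.
    by rewrite mul_mpolyC mulrC mul_mpolyC !scalerA mulrC.
  by rewrite !det_mulmx; apply: (idlMr hJ); apply: (idlMl hJ).
have -> : ((\sum_j N j).+1 = (\sum_(i | i != j) N i).+1 + N j)%N.
  by rewrite (bigD1 j) //= addSn addnC.
by rewrite exprD; apply: (idlMl hJ).
Qed.

End IsolatedZero.

(** * Second order operators on the hypersurface *)

Section Contorsion.
Variables (R : comNzRingType) (n : nat) (h : R).
Hypothesis hh : h + h = 1.

Lemma double_inj (x y : R) : x + x = y + y -> x = y.
Proof.
by move=> e; rewrite -[x]mul1r -[y]mul1r -hh !mulrDl -!mulrDr e.
Qed.

(* A tensor [T i j l] skew in [i, j] is the antisymmetrisation in [i, j] of a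
   tensor [S i j l] skew in [j, l], exactly as a torsion determines a metric
   contorsion. Adding [sum_l S i j l F_l] makes [u_i E_j] symmetric without
   changing its contraction with [F]. *)
Lemma symmetrize_modulo (u E F : 'I_n -> R) :
  (forall i j, gen_ideal F (u i * E j - u j * E i)) ->
  exists a : 'I_n -> 'I_n -> R,
    [/\ forall i j, a i j = a j i,
        forall i, \sum_j a i j * F j = u i * \sum_j E j * F j &
        forall i j, gen_ideal F (a i j - u i * E j)].
Proof.
move=> uE.
have [c cP] := fin_all_exists (fun i => fin_all_exists (uE i)).
pose T i j l := h * (c i j l - c j i l).
have Tskew i j l : T i j l = - T j i l by rewrite /T -mulrN opprB.
have TF i j : \sum_l T i j l * F l = u i * E j - u j * E i.
  have -> : \sum_l T i j l * F l =
      h * (\sum_l c i j l * F l - \sum_l c j i l * F l).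
    by rewrite -sumrB mulr_sumr; apply: eq_bigr => l _; rewrite /T; ring.
  rewrite -!cP; apply: double_inj; rewrite -mulrDl hh mul1r; ring.
pose S i j l := - h * (T i j l - T j l i + T l i j).
have Sskew i j l : S i j l = - S i l j.
  by rewrite /S (Tskew i l j) (Tskew l j i) (Tskew j i l); ring.
have ST i j l : S i j l - S j i l = - T i j l.
  rewrite /S (Tskew j i l) (Tskew i l j) (Tskew l j i).
  by transitivity (- ((h + h) * T i j l)); [ring | rewrite hh mul1r].
exists (fun i j => u i * E j + \sum_l S i j l * F l); split.
- move=> i j; apply/eqP; rewrite -subr_eq0 opprD addrACA -TF -sumrB -big_split.
  rewrite big1 // => l _ /=; rewrite -mulrBl ST; ring.
- move=> i; under eq_bigr => j _ do rewrite mulrDl.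
  rewrite big_split /= mulr_sumr.
  (* [S] is skew in [j] and [l], so exchanging the two indices shows that twice the sum is zero. *)
  have -> : \sum_j (\sum_l S i j l * F l) * F j = 0.
    apply: double_inj; rewrite addr0; under eq_bigr => j _ do rewrite mulr_suml.
    rewrite [X in _ + X]exchange_big -big_split big1 //= => j _.
    rewrite -big_split big1 //= => l _; rewrite (Sskew i l j); ring.
  by rewrite addr0; apply: eq_bigr => j _; rewrite mulrA.
- by move=> i j; rewrite addrAC subrr add0r; exists (S i j).
Qed.

End Contorsion.

(** * Brackets and operators of order at most two *)

Section DiffCriteria.
Variables (k : fieldType) (A : comAlgType k).
Implicit Types D : A -> A.

Lemma linear_commutator D a : linear D -> linear (commutator D a).
Proof.
move=> linD c x y; rewrite /commutator mulrDr -scalerAr !linD mulrDr -scalerAr.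
by rewrite scalerBr opprD addrACA.
Qed.

(** When [D 1 = 0] this is [[[D, x], y]] evaluated at [1], the polarised symbol of [D]. *)
Definition bracket D x y := D (x * y) - x * D y - y * D x.

(** The hypothesis turns [[[D, a], b]] into multiplication by [bracket D a b], which commutes with
    [A]. *)
Lemma Diff2I D : linear D ->
  (forall x y z, bracket D x (y * z) = y * bracket D x z + z * bracket D x y) ->
  Diff 2 D.
Proof.
move=> linD brD.
have comm2 a b x : commutator (commutator D a) b x = bracket D a b * x.
  rewrite [RHS]mulrC; have := brD a b x; rewrite addrC => /eqP.
  by rewrite -subr_eq => /eqP <-; rewrite /commutator /bracket; ring.
split=> // a; split=> [|b]; first exact: linear_commutator.
split=> [|c x]; first by do 2! apply: linear_commutator.
rewrite -[LHS]/(commutator (commutator D a) b (c * x) -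
                c * commutator (commutator D a) b x).
by rewrite !comm2 mulrCA subrr.
Qed.

Lemma Der1_Leibniz D x y : Der 1 D -> D (x * y) = x * D y + y * D x.
Proof.
case=> -[linD /(_ x)[_ /(_ y)/(_ 1)]]; rewrite /commutator !mulr1 => e D1.
apply/eqP; move/eqP: e; rewrite D1 mulr0 subr0 subr_eq0 subr_eq.
by rewrite addrC.
Qed.

End DiffCriteria.

(** * Descent of operators to the hypersurface *)

Section Hypersurface.
Variables (k : fieldType) (n : nat) (f : {mpoly k[n]}).
Variables (A : comAlgType k) (pi : {lrmorphism {mpoly k[n]} -> A}).
Hypothesis hA : is_quotient_by f pi.
Local Notation P := {mpoly k[n]}.
Local Notation F := (fun i => f^`M(i)).

Lemma pi_surj x : exists p, pi p == x.
Proof. by have [p <-] := hA.1 x; exists p. Qed.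

Definition lift_poly x : P := xchoose (pi_surj x).

Lemma lift_polyK : cancel lift_poly pi.
Proof. by move=> x; apply/eqP; exact: (xchooseP (pi_surj x)). Qed.

Lemma pi_f : pi f = 0.
Proof. by apply/hA.2; exists 1; rewrite mul1r. Qed.

Lemma pi_eq p q : pi p = pi q -> exists e, p - q = e * f.
Proof. by move=> e; apply/hA.2; rewrite rmorphB /= e subrr. Qed.

Section SecondOrder.
Variables (a : 'I_n -> 'I_n -> P) (c u : 'I_n -> P).
Hypothesis a_sym : forall i j, a i j = a j i.
Hypothesis aF : forall i, \sum_j a i j * F j = u i * f.
Hypothesis ac : \sum_i \sum_j a i j * f^`M(i)^`M(j) = \sum_l c l * F l.

Definition second_order (p : P) : P :=
  \sum_i \sum_j a i j * p^`M(i)^`M(j) - \sum_l c l * p^`M(l).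

Definition polar (p q : P) : P :=
  \sum_i \sum_j a i j * (p^`M(i) * q^`M(j)).

Lemma polar_sym p q : polar p q = polar q p.
Proof.
rewrite /polar exchange_big; apply: eq_bigr => i _; apply: eq_bigr => j _ /=.
by rewrite a_sym [p^`M(_) * _]mulrC.
Qed.

Lemma polarM p q r : polar p (q * r) = q * polar p r + r * polar p q.
Proof.
rewrite !mulr_sumr -big_split; apply: eq_bigr => i _.
rewrite !mulr_sumr -big_split; apply: eq_bigr => j _ /=.
by rewrite mderivM; ring.
Qed.

Lemma polar_f p : exists e, polar p f = e * f.
Proof.
exists (\sum_i p^`M(i) * u i); rewrite mulr_suml; apply: eq_bigr => i _.
rewrite -mulrA -aF mulr_sumr; apply: eq_bigr => j _; ring.
Qed.

Lemma second_order_linear : linear second_order.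
Proof.
move=> x p q; rewrite /second_order.
have -> : \sum_i \sum_j a i j * (x *: p + q)^`M(i)^`M(j) =
    x *: (\sum_i \sum_j a i j * p^`M(i)^`M(j)) +
    \sum_i \sum_j a i j * q^`M(i)^`M(j).
  rewrite scaler_sumr -big_split; apply: eq_bigr => i _ /=.
  rewrite scaler_sumr -big_split; apply: eq_bigr => j _ /=.
  by rewrite !(mderivD, mderivZ) mulrDr scalerAr.
have -> : \sum_l c l * (x *: p + q)^`M(l) =
    x *: (\sum_l c l * p^`M(l)) + \sum_l c l * q^`M(l).
  rewrite scaler_sumr -big_split; apply: eq_bigr => l _ /=.
  by rewrite mderivD mderivZ mulrDr scalerAr.
by rewrite scalerBr opprD addrACA.
Qed.

Lemma second_orderM p q : second_order (p * q) =
  p * second_order q + q * second_order p + (polar p q + polar p q).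
Proof.
rewrite {2}(polar_sym p q) /second_order !mulrBr !mulr_sumr.
have -> : \sum_i \sum_j a i j * (p * q)^`M(i)^`M(j) =
    \sum_i p * (\sum_j a i j * q^`M(i)^`M(j)) +
    \sum_i q * (\sum_j a i j * p^`M(i)^`M(j)) + (polar p q + polar q p).
  rewrite /polar -!big_split; apply: eq_bigr => i _ /=.
  rewrite !mulr_sumr -!big_split; apply: eq_bigr => j _ /=.
  by rewrite !mderivM mderivD !mderivM; ring.
have -> : \sum_l c l * (p * q)^`M(l) =
    \sum_l p * (c l * q^`M(l)) + \sum_l q * (c l * p^`M(l)).
  by rewrite -big_split; apply: eq_bigr => l _ /=; rewrite mderivM; ring.
by ring.
Qed.

Lemma second_order_f : second_order f = 0.
Proof. by rewrite /second_order ac subrr. Qed.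

Lemma second_order_1 : second_order 1 = 0.
Proof.
rewrite /second_order -mpolyC1 !big1 ?subr0 // => i _.
  by rewrite mderivC mulr0.
by rewrite big1 // => j _; rewrite mderivC mderiv0 mulr0.
Qed.

Definition second_order_quot (x : A) : A := pi (second_order (lift_poly x)).

(** Two lifts differ by some [e f], and [D(e f) = e D f + f D e + 2 polar e f], where [D f = 0] by
    [ac] and [polar e f] is a multiple of [f] by [aF]. *)
Lemma second_order_quotE p : second_order_quot (pi p) = pi (second_order p).
Proof.
have [e] := pi_eq (lift_polyK (pi p)); set q := lift_poly _ => qe.
rewrite /second_order_quot -/q.
have -> : q = (1 : k) *: (e * f) + p by rewrite scale1r -qe subrK.
rewrite second_order_linear second_orderM second_order_f mulr0 add0r scale1r.
have [g ->] := polar_f e.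
by rewrite !(rmorphD, rmorphM) /= pi_f !(mulr0, mul0r) !add0r.
Qed.

Lemma bracket_second_order p q :
  bracket second_order_quot (pi p) (pi q) = pi (polar p q + polar p q).
Proof.
rewrite /bracket -rmorphM !second_order_quotE -!rmorphM -!rmorphB; congr (pi _).
by rewrite second_orderM; ring.
Qed.

Lemma Der2_second_order : Der 2 second_order_quot.
Proof.
split; last by rewrite -(rmorph1 pi) second_order_quotE second_order_1 rmorph0.
apply: Diff2I => [x y z|x y z].
  rewrite -(lift_polyK y) -(lift_polyK z) -linearP.
  by rewrite !second_order_quotE second_order_linear linearP.
rewrite -(lift_polyK x) -(lift_polyK y) -(lift_polyK z) -rmorphM.
rewrite !bracket_second_order -!rmorphM -rmorphD; congr (pi _).
by rewrite polarM; ring.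
Qed.

End SecondOrder.

(** * Vector fields tangent to the hypersurface *)

Section DerivationLifts.
Variable delta : A -> A.
Hypothesis der_delta : Der 1 delta.
Variable v : 'I_n -> P.
Hypothesis vP : forall i, pi (v i) = delta (pi 'X_i).

Lemma derivation_lift p : delta (pi p) = pi (\sum_i v i * p^`M(i)).
Proof.
have [[lin_delta _] delta1] := der_delta.
have lin_v : linear (fun p : P => \sum_i v i * p^`M(i)).
  move=> x q r; rewrite scaler_sumr -big_split; apply: eq_bigr => i _ /=.
  by rewrite mderivD mderivZ mulrDr scalerAr.
have M q r : delta (pi q) = pi (\sum_i v i * q^`M(i)) ->
    delta (pi r) = pi (\sum_i v i * r^`M(i)) ->
    delta (pi (q * r)) = pi (\sum_i v i * (q * r)^`M(i)).
  move=> eq er; rewrite rmorphM Der1_Leibniz // eq er -!rmorphM -rmorphD.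
  congr (pi _); rewrite !mulr_sumr -big_split; apply: eq_bigr => i _ /=.
  by rewrite mderivM; ring.
have E1 : delta (pi 1) = pi (\sum_i v i * 1^`M(i)).
  rewrite rmorph1 delta1 big1 ?rmorph0 // => i _.
  by rewrite -mpolyC1 mderivC mulr0.
elim/mpolyind: p => [|c m p _ _ IHp].
  rewrite rmorph0 big1 ?rmorph0 => [|i _]; last by rewrite mderiv0 mulr0.
  (* Linearity at [- 1], [0], [0] yields [delta 0 = 0]. *)
  by have := lin_delta (- 1) 0 0; rewrite scaleN1r addr0 oppr0 scaleN1r addNr.
rewrite linearP lin_delta IHp lin_v linearP; congr (_ *: _ + _).
rewrite mpolyXE_id; apply: (big_ind (fun q : P =>
  delta (pi q) = pi (\sum_i v i * q^`M(i)))) => // i _.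
elim: (m i) => [//|e IHe]; rewrite exprS; apply: M => //.
rewrite (bigD1 i) //= mderivX mnm1E eqxx scale1r big1 => [|j /negPf nj].
  have -> : (U_(i) - U_(i) = 0)%MM by apply/mnmP=> j; rewrite mnmBE subnn mnm0E.
  by rewrite mpolyX0 mulr1 addr0 vP.
by rewrite mderivX mnm1E eq_sym nj scale0r mulr0.
Qed.

Lemma derivation_tangent : exists e, \sum_i v i * F i = e * f.
Proof.
apply/hA.2; rewrite -derivation_lift pi_f.
have [[lin_delta _] _] := der_delta.
by have := lin_delta (- 1) 0 0; rewrite scaleN1r addr0 oppr0 scaleN1r addNr.
Qed.

(** Differentiating [v f = e f] along [x_l] produces [H v] and terms that lie in the Jacobian
    ideal. *)
Lemma hessian_tangent l : gen_ideal F f ->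
  gen_ideal F (\sum_i hessian f l i * v i).
Proof.
move=> Jf; have [e /(congr1 (mderiv l))] := derivation_tangent.
have hJ : is_ideal (gen_ideal F) by apply: is_ideal_gen.
rewrite mderivM raddf_sum /=; under eq_bigr => i _ do rewrite mderivM.
rewrite big_split /= => eqn.
have -> : \sum_i hessian f l i * v i =
    e^`M(l) * f + e * F l - \sum_i (v i)^`M(l) * F i.
  rewrite -eqn addrAC subrr add0r; apply: eq_bigr => i _.
  by rewrite mxE mulrC mderiv_comm.
apply: (idlB hJ); last by exists (fun i => (v i)^`M(l)).
apply: (idlD hJ); first exact: (idlMl hJ).
by apply: (idlMl hJ); exact: mem_gen_ideal.
Qed.

End DerivationLifts.

(* [b] plays the role of a principal symbol preserving [(f)]: its contraction
   with [df] is [f u], and the class of [u] modulo the Jacobian ideal is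
   killed by the Hessian. *)
Definition hessian_null_symbol (b : 'I_n -> 'I_n -> P) : Prop :=
  exists u : 'I_n -> P,
    (forall i, \sum_j b i j * F j = u i * f) /\
    (forall l, gen_ideal F (\sum_i hessian f l i * u i)).

Lemma hessian_null_sum m (c : 'I_m -> P) (b : 'I_m -> 'I_n -> 'I_n -> P) :
  (forall s, hessian_null_symbol (b s)) ->
  hessian_null_symbol (fun i j => \sum_s c s * b s i j).
Proof.
move=> /fin_all_exists[u bu].
exists (fun i => \sum_s c s * u s i); split=> [i|l].
  under eq_bigr => j _ do rewrite mulr_suml.
  rewrite exchange_big mulr_suml; apply: eq_bigr => s _ /=.
  rewrite -mulrA -(bu s).1 mulr_sumr; apply: eq_bigr => j _.
  exact: esym (mulrA _ _ _).
have hJ : is_ideal (gen_ideal F) by apply: is_ideal_gen.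
under eq_bigr => i _ do rewrite mulr_sumr.
rewrite exchange_big; apply: idl_sum => // s _ /=.
under eq_bigr => i _ do rewrite mulrCA.
by rewrite -mulr_sumr; apply: (idlMl hJ); exact: (bu s).2.
Qed.

Lemma bracket_derivation (delta : A -> A) x y :
  Der 1 delta -> bracket delta x y = 0.
Proof. by move=> der_d; rewrite /bracket Der1_Leibniz //; ring. Qed.

Lemma bracket_comp (d1 d2 : A -> A) x y : Der 1 d1 -> Der 1 d2 ->
  bracket (d1 \o d2) x y = d1 x * d2 y + d1 y * d2 x.
Proof.
move=> der1 der2; have [[lin1 _] _] := der1.
have d1D a b : d1 (a + b) = d1 a + d1 b.
  by have := lin1 1 a b; rewrite !scale1r.
rewrite /bracket /= (Der1_Leibniz _ _ der2) d1D !(Der1_Leibniz _ _ der1); ring.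
Qed.

(** A single derivation has zero bracket. For two, the symbol is the symmetrised product of the
    fields [v1], [v2]; its contraction with [df] is [f (e2 v1 + e1 v2)], and the Hessian kills both
    fields modulo the Jacobian ideal. *)
Lemma composition_symbol (E : A -> A) : gen_ideal F f -> is_composition 2 E ->
  exists b, hessian_null_symbol b /\
    forall i j, bracket E (pi 'X_i) (pi 'X_j) = pi (b i j).
Proof.
have hJ : is_ideal (gen_ideal F) by apply: is_ideal_gen.
move=> Jf [s [delta [s12 der_delta ->]]].
case: s delta s12 der_delta => [|[|[|s]]] //= delta _ der_delta.
  exists (fun _ _ => 0); split.
    exists (fun=> 0); split=> [i|l].
      by rewrite mul0r big1 // => j _; rewrite mul0r.
    by rewrite big1 => [|i _]; [exact: (idl0 hJ) | rewrite mulr0].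
  move=> i j; rewrite /composition big_ord_recl big_ord0 rmorph0.
  exact: (bracket_derivation _ _ (der_delta ord0)).
rewrite /composition !big_ord_recl big_ord0.
set d1 := delta _; set d2 := delta _.
have der1 : Der 1 d1 := der_delta _.
have der2 : Der 1 d2 := der_delta _.
pose v (d : A -> A) i := lift_poly (d (pi 'X_i)).
have vP d i : pi (v d i) = d (pi 'X_i) by exact: lift_polyK.
have [e1 v1] := derivation_tangent der1 (vP d1).
have [e2 v2] := derivation_tangent der2 (vP d2).
exists (fun i j => v d1 i * v d2 j + v d1 j * v d2 i); split; last first.
  move=> i j; rewrite -[d2 \o id]/d2 bracket_comp //.
  by rewrite rmorphD !rmorphM /= !vP.
exists (fun i => e2 * v d1 i + e1 * v d2 i); split=> [i|l].
  transitivity (v d1 i * (\sum_j v d2 j * F j) + v d2 i * \sum_j v d1 j * F j).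
    rewrite !mulr_sumr -big_split; apply: eq_bigr => j _ /=; ring.
  by rewrite v1 v2; ring.
have -> : \sum_i hessian f l i * (e2 * v d1 i + e1 * v d2 i) =
    e2 * (\sum_i hessian f l i * v d1 i) + e1 * \sum_i hessian f l i * v d2 i.
  rewrite !mulr_sumr -big_split; apply: eq_bigr => i _ /=; ring.
apply: (idlD hJ); apply: (idlMl hJ).
  exact: (hessian_tangent der1 (vP d1)).
exact: (hessian_tangent der2 (vP d2)).
Qed.

(** The bracket is [A]-linear in the operator, so the symbols of the generators can be combined. *)
Lemma der2_symbol (D : A -> A) : gen_ideal F f -> der 2 D ->
  exists b, hessian_null_symbol b /\
    forall i j, bracket D (pi 'X_i) (pi 'X_j) = pi (b i j).
Proof.
move=> Jf [m [c [E [compE DE]]]].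
have [b bP] := fin_all_exists (fun s => composition_symbol Jf (compE s)).
exists (fun i j => \sum_s lift_poly (c s) * b s i j); split.
  by apply: hessian_null_sum => s; exact: (bP s).1.
move=> i j; rewrite /bracket !DE !mulr_sumr -!sumrB rmorph_sum.
apply: eq_bigr => s _; rewrite rmorphM /= lift_polyK -(bP s).2 /bracket; ring.
Qed.

End Hypersurface.

(** The index [l] selects the row of cofactors and ensures that there is a variable. *)
Lemma der2_neq_Der2 (k : closedFieldType) n (f : {mpoly k[n]}) (l : 'I_n)
    (A : comAlgType k) (pi : {lrmorphism {mpoly k[n]} -> A}) :
  [pchar k] =i pred0 -> weighted_homogeneous f ->
  isolated_hypersurface_singularity f -> is_quotient_by f pi ->
  ~ der_eq_Der A 2.
Proof.
move=> hchar hwh iso hA derA.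
have detH := det_hessian_notin hchar hwh iso.
have [w [d [w0 d0 hf]]] := hwh.
pose F (i : 'I_n) := f^`M(i); rewrite -[gen_ideal _]/(gen_ideal F) in detH.
have hJ : is_ideal (gen_ideal F) by apply: is_ideal_gen.
have nat0 m : (0 < m)%N -> m%:R != 0 :> k.
  by move/pcharf0P: hchar => ->; rewrite lt0n.
have fE : d%:R *: f = \sum_j (w j)%:R *: 'X_j * F j.
  by rewrite -(euler hf); apply: eq_bigr => j _; rewrite scalerAl.
have Jf : gen_ideal F f.
  exists (fun j => d%:R^-1 *: ((w j)%:R *: 'X_j)).
  under eq_bigr => j _ do rewrite -scalerAl.
  by rewrite -scaler_sumr -fE scalerA mulVf ?nat0 // scale1r.
pose H := hessian f; pose u i := cofactor H l i.
pose E (i : 'I_n) : {mpoly k[n]} := (w i)%:R *: 'X_i.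
have HE i : gen_ideal F (\sum_j H i j * E j).
  rewrite (_ : \sum_j _ = (d%:R - (w i)%:R)%:MP * F i).
    by apply: (idlMl hJ); exact: mem_gen_ideal.
  rewrite mul_mpolyC -(euler_deriv i hf); apply: eq_bigr => j _.
  by rewrite mxE mulrC scalerAl.
have uE i j : gen_ideal F (u i * E j - u j * E i) by apply: cofactor_exchange.
have half : (2%:R^-1)%:MP + (2%:R^-1)%:MP = 1 :> {mpoly k[n]}.
  by rewrite -mpolyCD -mulr2n -[_ *+ 2]mulr_natr mulVf ?nat0 // mpolyC1.
have [a [a_sym aE aJ]] := symmetrize_modulo half uE.
have aF i : \sum_j a i j * F j = (d%:R *: u i) * f.
  by rewrite aE -[\sum_j _]fE -scalerAr -scalerAl.
(* Modulo the Jacobian ideal [a i j] is [u i * E j], and [H E] lies in that ideal; [c] is the first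
   order correction that makes the operator kill [f]. *)
have [c ac] : gen_ideal F (\sum_i \sum_j a i j * f^`M(i)^`M(j)).
  have -> : \sum_i \sum_j a i j * f^`M(i)^`M(j) =
      \sum_i \sum_j f^`M(i)^`M(j) * (a i j - u i * E j) +
      \sum_i u i * (\sum_j H i j * E j).
    rewrite -big_split; apply: eq_bigr => i _ /=.
    rewrite mulr_sumr -big_split; apply: eq_bigr => j _ /=.
    by rewrite mxE; ring.
  apply: (idlD hJ); apply: idl_sum => // i _; last exact: (idlMl hJ).
  by apply: idl_sum => // j _; exact: (idlMl hJ).
have derD := (derA _).2 (Der2_second_order hA a_sym aF ac).
have [b [[v [bF Hv]] bD]] := der2_symbol hA Jf derD.
have polarX i j : polar a 'X_i 'X_j = a i j.
  have dX (s t : 'I_n) : 'X_s^`M(t) = (s == t)%:R :> {mpoly k[n]}.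
    rewrite mderivX mnm1E; case: eqP => [->|_]; last by rewrite scale0r.
    have -> : (U_(t) - U_(t) = 0)%MM.
      by apply/mnmP=> s'; rewrite mnmBE subnn mnm0E.
    by rewrite mpolyX0 scale1r.
  rewrite /polar (bigD1 i) //= [X in _ + X]big1 ?addr0 => [|s /negPf si].
    rewrite (bigD1 j) //= big1 => [|s /negPf sj]; last first.
      by rewrite !dX [j == s]eq_sym sj mulr0 mulr0.
    by rewrite !dX !eqxx !mulr1 addr0.
  by rewrite big1 // => t _; rewrite !dX [i == s]eq_sym si mul0r mulr0.
(* The bracket of the operator is twice its symbol, so [2 a] and [b] agree modulo [f]. *)
have abE i j : exists e, a i j + a i j - b i j = e * f.
  apply: (pi_eq hA).
  by rewrite -bD (bracket_second_order hA a_sym aF ac) polarX.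
have [e eP] := fin_all_exists (fun i => fin_all_exists (abE i)).
have f0 : f != 0.
  apply: contra_notN detH => /eqP f0; rewrite (expand_det_row _ l) big1.
    exact: (idl0 hJ).
  by move=> i _; rewrite mxE f0 !mderiv0 mul0r.
(* Contract [2 a = b + e f] with [df], then cancel [f]. *)
have uv i : d%:R *: u i + d%:R *: u i = v i + \sum_j e i j * F j.
  apply: (mulIf f0); rewrite !mulrDl -aF -bF mulr_suml -!big_split.
  apply: eq_bigr => j _ /=.
  have -> : e i j * F j * f = (a i j + a i j - b i j) * F j by rewrite eP; ring.
  by ring.
(* Expansion along row [l] gives [\det H] as the sum of the [H l i * u i]; [uv] supplies [2 d u i],
   and [2 d] is invertible. *)
apply: detH; have -> : \det (hessian f) =
    ((2 * d)%:R^-1)%:MP * \sum_i H l i * (v i + \sum_j e i j * F j).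
  under eq_bigr => i _ do
    rewrite -uv -mulr2n -scaler_nat scalerA -natrM -scalerAr.
  rewrite -scaler_sumr -expand_det_row mul_mpolyC scalerA.
  by rewrite mulVf ?scale1r // nat0 ?muln_gt0.
apply: (idlMl hJ); under eq_bigr => i _ do rewrite mulrDr.
rewrite big_split; apply: (idlD hJ); first exact: Hv.
apply: idl_sum => // i _; apply: (idlMl hJ).
by exists (e i).
Qed.

(** Nonzero scalars are invertible, so the only proper ideal is zero: the algebra has dimension [0]
    and is its own localization. *)
Lemma scalar_algebra_regular (k : fieldType) (A : comAlgType k) :
  (forall x : A, exists c : k, x = c%:A) -> regular A.
Proof.
move=> scal; pose zero_ideal : {pred A} := pred1 0.
have ideal0 (I : {pred A}) : idealr_closed I -> I =i pred1 0.
  move=> [I0 I1 ID] x; rewrite inE; apply/idP/eqP => [|-> //].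
  have [c ->] := scal x; have [->|c0] := eqVneq c 0; first by rewrite scale0r.
  move=> Ic; case/negP: I1.
  have := ID (c^-1)%:A _ _ Ic I0.
  by rewrite addr0 -scalerAl mul1r scalerA mulVf // scale1r.
have closed0 : idealr_closed (pred1 (0 : A)).
  split; rewrite ?inE ?oner_eq0 // => a x y /eqP -> /eqP ->.
  by rewrite mulr0 addr0 inE.
have prime0 : prime_ideal (pred1 (0 : A)).
  split=> // x y; rewrite !inE; have [c ->] := scal x.
  have [->|c0] := eqVneq c 0; first by rewrite scale0r eqxx.
  move=> /eqP e; apply/orP; right; apply/eqP.
  by rewrite -[y]scale1r -(mulVf c0) -scalerA -[c *: y]mulr_algl e scaler0.
have gen0 (I : {pred A}) : I =i pred1 0 -> generated_by I 0.
  move=> I0; exists (fun=> 0) => x; rewrite I0 inE; split.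
    by move=> /eqP ->; exists (fun=> 0); rewrite big_ord0.
  by case=> c ->; rewrite big_ord0.
have noeth : noetherian A by move=> I /ideal0/gen0 gI; exists 0%N.
have local : regular_local A.
  split=> //; exists zero_ideal; split.
  - by split=> // J /ideal0.
  - by move=> m' [/ideal0].
  - exists 0%N; last exact: gen0.
    split; first by exists (fun=> zero_ideal).
    move=> l c [cP cS]; rewrite leqNgt; apply/negP => l0.
    have [c0 [c1 _]] := ((cP 0%N isT).1, cP 1%N l0).
    have [_ [x]] := cS 0%N l0.
    by rewrite (ideal0 _ c1) (ideal0 _ c0) => ->.
split=> // p [pI pP]; exists A, idfun; split=> //; split.
- move=> s; rewrite (ideal0 _ pI) inE; have [c ->] := scal s => cs.
  have c0 : c != 0 by apply: contraNneq cs => ->; rewrite scale0r.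
  exists (c^-1)%:A; by rewrite /= -scalerAl mul1r scalerA mulfV // scale1r.
- move=> z; exists z, 1; split; last by rewrite /= mulr1.
  by case: pI.
- move=> a /=; split=> [->|[s]].
    by exists 1; rewrite ?mulr0 //; case: pI.
  rewrite (ideal0 _ pI) inE; have [c ->] := scal s => cs.
  have c0 : c != 0 by apply: contraNneq cs => ->; rewrite scale0r.
  rewrite mulr_algl => e.
  by rewrite -[a]scale1r -(mulVf c0) -scalerA e scaler0.
Qed.

Theorem mainTheorem1 (k : closedFieldType) (hchar : [pchar k] =i pred0)
    (n : nat) (f : {mpoly k[n]})
    (hwh : weighted_homogeneous f)
    (hiso : isolated_hypersurface_singularity f)
    (A : comAlgType k) (pi : {lrmorphism {mpoly k[n]} -> A})
    (hA : is_quotient_by f pi) :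
  [/\ ~ regular A -> ~ der_eq_Der A 2,
      der_eq_Der A 2 -> regular A &
      (forall q : nat, (1 <= q)%N -> der_eq_Der A q) -> regular A].
Proof.
have der2_regular : der_eq_Der A 2 -> regular A.
  (* With at least one variable the assumption is contradictory; with none, every element of [A] is
     a scalar. *)
  case: n f hwh hiso pi hA => [|n] f hwh hiso pi hA; last first.
    by move=> /(der2_neq_Der2 ord0 hchar hwh hiso hA).
  move=> _; apply: scalar_algebra_regular => x.
  have [p <-] := hA.1 x; exists p@_0.
  by rewrite -(rmorph1 pi) -linearZ /= alg_mpolyC -nvar0_mpolyC.
split=> // [nreg /der2_regular //|derA]; exact: (der2_regular (derA 2 isT)).
Qed.
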